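(* If $E$ is a ceer with infinitely many equivalence classes, then $\mathsf{id}<E^+$.
   Context: A ceer is an equivalence relation on $\mathbb N$ that is computably enumerable as a set of pairs. $\mathsf{id}$ is the identity relation on $\mathbb N$. $\phi_e$ is the $e$-th partial computable function. The computable FS-jump is $E^+$ on $\mathbb N$ with $e\mathrel{E^+}e'$ iff $\{[\phi_e(n)]_E:\phi_e(n)\downarrow\}=\{[\phi_{e'}(n)]_E:\phi_{e'}(n)\downarrow\}$. $E\leq F$ means there is a total computable $f$ with $x\mathrel{E}y\iff f(x)\mathrel{F}f(y)$; $E<F$ means $E\leq F$ and $F\not\leq E$. *)

(* Defs.v *)
From Stdlib Require Import Arith Lia List Ensembles Relations RelationClasses Cantor.

Set Implicit Arguments.

Notation "⟨ x , y ⟩" := (Cantor.to_nat (x, y)) (at level 0, x, y at level 99).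

(** The unary partial computable functions are the smallest class of partial
    functions on [nat] that contains zero, successor and the two projections of
    Cantor's pairing and is closed under pairing, composition, primitive
    recursion and unbounded search.  [code] is the syntax of this class. *)
Inductive code : Set :=
| Zero
| Succ
| Left
| Right
| Pair (f g : code)
| Comp (f g : code)
| Prec (f g : code)
| Mu (f : code).

(** [eval c x y] means that the partial function with code [c] is defined at
    [x] with value [y]:
    - [Prec f g] is [h] with [h ⟨a, 0⟩ = f a] and
      [h ⟨a, S m⟩ = g ⟨a, ⟨m, h ⟨a, m⟩⟩⟩];
    - [Mu f] maps [x] to the least [n] with [f ⟨x, n⟩ = 0], and is defined only
      if [f ⟨x, m⟩] is defined for every [m < n]. *)
Fixpoint eval (c : code) (x y : nat) : Prop :=
  match c with
  | Zero => y = 0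
  | Succ => y = S x
  | Left => y = fst (Cantor.of_nat x)
  | Right => y = snd (Cantor.of_nat x)
  | Pair f g => exists u v, eval f x u /\ eval g x v /\ y = ⟨u, v⟩
  | Comp f g => exists u, eval g x u /\ eval f u y
  | Prec f g =>
      let a := fst (Cantor.of_nat x) in
      (fix rec (n z : nat) : Prop :=
         match n with
         | 0 => eval f a z
         | S m => exists u, rec m u /\ eval g ⟨a, ⟨m, u⟩⟩ z
         end) (snd (Cantor.of_nat x)) y
  | Mu f => eval f ⟨x, y⟩ 0 /\ forall m, m < y -> exists k, eval f ⟨x, m⟩ (S k)
  end.

Lemma eval_functional (c : code) :
  forall x y z, eval c x y -> eval c x z -> y = z.
Proof.
  induction c as [| | | |f IHf g IHg|f IHf g IHg|f IHf g IHg|f IHf];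
    intros x y z; cbn [eval]; try congruence.
  - intros (u & v & Hu & Hv & ->) (u' & v' & Hu' & Hv' & ->).
    rewrite (IHf _ _ _ Hu Hu'), (IHg _ _ _ Hv Hv'); reflexivity.
  - intros (u & Hu & Hy) (u' & Hu' & Hz).
    rewrite (IHg _ _ _ Hu' Hu) in Hz; eauto.
  - generalize (snd (Cantor.of_nat x)); intros n; revert y z.
    induction n as [|n IHn]; intros y z; [apply IHf|].
    intros (u & Hu & Hy) (u' & Hu' & Hz).
    rewrite (IHn _ _ Hu' Hu) in Hz; eauto.
  - intros [Hy Hy'] [Hz Hz'].
    destruct (Nat.lt_trichotomy y z) as [H|[H|H]]; trivial; exfalso.
    + destruct (Hz' _ H) as [k Hk]; discriminate (IHf _ _ _ Hy Hk).
    + destruct (Hy' _ H) as [k Hk]; discriminate (IHf _ _ _ Hz Hk).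
Qed.

Fixpoint encode (c : code) : nat :=
  match c with
  | Zero => 0
  | Succ => 1
  | Left => 2
  | Right => 3
  | Pair f g => 4 + 4 * ⟨encode f, encode g⟩
  | Comp f g => 5 + 4 * ⟨encode f, encode g⟩
  | Prec f g => 6 + 4 * ⟨encode f, encode g⟩
  | Mu f => 7 + 4 * encode f
  end.

Lemma encode_inj (c d : code) : encode c = encode d -> c = d.
Proof.
  assert (inj2 : forall a b a' b', ⟨a, b⟩ = ⟨a', b'⟩ -> a = a' /\ b = b').
  { intros a b a' b' H; apply Cantor.to_nat_inj in H.
    injection H; auto. }
  revert d; induction c; intros []; cbn [encode]; intros H;
    try reflexivity; try (exfalso; lia);
    try (f_equal; match goal with IH : forall d, _ |- _ => apply IH end; lia);
    (match type of H with
     | _ + 4 * ?p = _ + 4 * ?q => assert (E : p = q) by lia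
     end; apply inj2 in E; destruct E; f_equal; auto).
Qed.

Lemma encode_surj (e : nat) : exists c, encode c = e.
Proof.
  induction e as [e IH] using (well_founded_induction lt_wf).
  destruct (Nat.lt_ge_cases e 4) as [He|He].
  - destruct e as [|[|[|[|e]]]];
      [exists Zero|exists Succ|exists Left|exists Right|lia]; reflexivity.
  - pose proof (Nat.div_mod_eq (e - 4) 4) as D.
    pose proof (Nat.mod_upper_bound (e - 4) 4) as M.
    set (q := (e - 4) / 4) in *; set (r := (e - 4) mod 4) in *.
    destruct (Cantor.of_nat q) as [a b] eqn:Q.
    assert (P : ⟨a, b⟩ = q) by (rewrite <- Q; apply Cantor.cancel_to_of).
    pose proof (Cantor.to_nat_non_decreasing a b) as B.
    destruct (IH a) as [f Hf]; [lia|].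
    destruct (IH b) as [g Hg]; [lia|].
    destruct (IH q) as [h Hh]; [lia|].
    assert (C : r = 0 \/ r = 1 \/ r = 2 \/ r = 3) by lia.
    destruct C as [C|[C|[C|C]]];
      [exists (Pair f g)|exists (Comp f g)|exists (Prec f g)|exists (Mu h)];
      cbn [encode]; rewrite ?Hf, ?Hg, ?Hh, ?P; lia.
Qed.

(** [phi e n y] means that [φ_e(n)] is defined and equal to [y].  As [encode] is
    a bijection, every [e] is the index of exactly one code. *)
Definition phi (e n y : nat) : Prop := exists c, encode c = e /\ eval c n y.

Definition computable (f : nat -> nat) : Prop := exists e, forall n, phi e n (f n).

(** A set of pairs is computably enumerable if it is the domain of a partial
    computable function. *)
Definition ce_pairs (E : relation nat) : Prop :=
  exists e, forall x y, E x y <-> exists z, phi e ⟨x, y⟩ z.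

Definition ceer (E : relation nat) : Prop := Equivalence E /\ ce_pairs E.

Definition eclass (E : relation nat) (x : nat) : Ensemble nat := fun y => E x y.

(** No finite list meets every class. *)
Definition infinitely_many_classes (E : relation nat) : Prop :=
  ~ exists l : list nat, forall x, exists y, List.In y l /\ E x y.

(** The set of classes [{[φ_e(n)]_E : φ_e(n)↓}].  Sets are compared with
    [Same_set] at both levels, so that no extensionality axiom is needed. *)
Definition enumerated_classes (E : relation nat) (e : nat) : Ensemble (Ensemble nat) :=
  fun C => exists n y, phi e n y /\ Same_set nat C (eclass E y).

Definition FS_jump (E : relation nat) : relation nat :=
  fun e e' => Same_set (Ensemble nat) (enumerated_classes E e) (enumerated_classes E e').

Definition reducible (E F : relation nat) : Prop :=
  exists f, computable f /\ forall x y, E x y <-> F (f x) (f y).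

Definition strictly_reducible (E F : relation nat) : Prop :=
  reducible E F /\ ~ reducible F E.

(* Main.v *)
Require Import Defs.
From Stdlib Require Import Relations.
From Stdlib Require Import Arith Lia List RelationClasses Cantor Classical.

(** Call [x] fresh if it is not [E]-equivalent to a smaller number.  Let [W_n] be
    the set of numbers reached from [0] by successor steps of which [n] are free
    and every other step, to [S x], is justified by some [v <= x] with [E (S x) v].
    A justification is a finite object, so [W_n] is the range of a partial
    computable function whose index is computable from [n].  At most [n] of the
    numbers in [1..x] are fresh when [x] is in [W_n], whereas [W_m] contains the
    [m]-th positive fresh number; this separates [W_n] from [W_m] for [n < m].

    Conversely, a reduction of [E^+] to equality would decide whether [φ_e] is
    nowhere defined.  Applied to the constant programs [φ_e(e)], this yields a
    program halting on [e] exactly if [φ_e(e)] diverges. *)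

(** * Computable functions and their closure properties *)

Lemma phi_encode (c : code) (n y : nat) : phi (encode c) n y <-> eval c n y.
Proof.
  split.
  - intros (d & Hd & H). apply encode_inj in Hd. now subst d.
  - intros H. now exists c.
Qed.

Lemma computableP (f : nat -> nat) :
  computable f <-> exists c, forall n, eval c n (f n).
Proof.
  split.
  - intros [e H]. destruct (encode_surj e) as [c <-].
    exists c. intros n. now apply phi_encode.
  - intros [c H]. exists (encode c). intros n. now apply phi_encode.
Qed.

Lemma eval_Prec_0 (f g : code) (a y : nat) :
  eval (Prec f g) ⟨a, 0⟩ y <-> eval f a y.
Proof. cbn [eval]. rewrite Cantor.cancel_of_to. reflexivity. Qed.

Lemma eval_Prec_S (f g : code) (a n y : nat) :
  eval (Prec f g) ⟨a, S n⟩ y <->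
  exists u, eval (Prec f g) ⟨a, n⟩ u /\ eval g ⟨a, ⟨n, u⟩⟩ y.
Proof. cbn [eval]. rewrite !Cantor.cancel_of_to. reflexivity. Qed.

Definition left (z : nat) : nat := fst (Cantor.of_nat z).
Definition right (z : nat) : nat := snd (Cantor.of_nat z).

Lemma left_pair (x y : nat) : left ⟨x, y⟩ = x.
Proof. unfold left. now rewrite Cantor.cancel_of_to. Qed.

Lemma right_pair (x y : nat) : right ⟨x, y⟩ = y.
Proof. unfold right. now rewrite Cantor.cancel_of_to. Qed.

Lemma pair_left_right (z : nat) : ⟨left z, right z⟩ = z.
Proof.
  unfold left, right. rewrite <- surjective_pairing. apply Cantor.cancel_to_of.
Qed.

Lemma computable_ext (f g : nat -> nat) :
  (forall x, f x = g x) -> computable f -> computable g.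
Proof. intros H [e He]. exists e. intros n. rewrite <- H. apply He. Qed.

Lemma computable_id : computable (fun x => x).
Proof.
  apply computableP. exists (Pair Left Right). intros n.
  exists (left n), (right n). split; [reflexivity|split; [reflexivity|]].
  now rewrite pair_left_right.
Qed.

Lemma computable_comp (f g : nat -> nat) :
  computable f -> computable g -> computable (fun x => f (g x)).
Proof.
  intros [c Hc]%computableP [d Hd]%computableP. apply computableP.
  exists (Comp c d). intros n. exists (g n). auto.
Qed.

Lemma computable_pair (f g : nat -> nat) :
  computable f -> computable g -> computable (fun x => ⟨f x, g x⟩).
Proof.
  intros [c Hc]%computableP [d Hd]%computableP. apply computableP.
  exists (Pair c d). intros n. exists (f n), (g n). auto.
Qed.

Lemma computable_left (f : nat -> nat) :
  computable f -> computable (fun x => left (f x)).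
Proof.
  apply (computable_comp left). apply computableP. now exists Left.
Qed.

Lemma computable_right (f : nat -> nat) :
  computable f -> computable (fun x => right (f x)).
Proof.
  apply (computable_comp right). apply computableP. now exists Right.
Qed.

Lemma computable_S (f : nat -> nat) :
  computable f -> computable (fun x => S (f x)).
Proof.
  apply (computable_comp S). apply computableP. now exists Succ.
Qed.

Lemma computable_const (k : nat) : computable (fun _ => k).
Proof.
  induction k as [|k IH].
  - apply computableP. now exists Zero.
  - now apply computable_S.
Qed.

Create HintDb computability.
#[local] Hint Resolve computable_id computable_pair computable_left
  computable_right computable_S computable_const : computability.

(** The function [r] of parameter and counter is what [Prec] computes on a packed argument;
    composing with [z ↦ ⟨z, h z⟩] lets the counter depend on [z]. *)
Lemma computable_nat_rect (f g h : nat -> nat) :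
  computable f -> computable g -> computable h ->
  computable (fun z =>
    nat_rect (fun _ => nat) (f z) (fun m u => g ⟨z, ⟨m, u⟩⟩) (h z)).
Proof.
  intros [c Hc]%computableP [d Hd]%computableP Hh.
  set (r := fun z n =>
    nat_rect (fun _ => nat) (f z) (fun m u => g ⟨z, ⟨m, u⟩⟩) n).
  assert (Hr : computable (fun w => r (left w) (right w))).
  { apply computableP. exists (Prec c d). intros w.
    rewrite <- (pair_left_right w) at 1.
    generalize (left w) (right w). intros a n.
    induction n as [|n IH].
    - apply eval_Prec_0, Hc.
    - apply eval_Prec_S. exists (r a n). split; [apply IH|apply Hd]. }
  apply (computable_ext (fun z => r (left ⟨z, h z⟩) (right ⟨z, h z⟩))).
  - intros z. now rewrite left_pair, right_pair.
  - apply (computable_comp (fun w => r (left w) (right w)));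
      auto with computability.
Qed.

Lemma computable_iter (f g h : nat -> nat) :
  computable f -> computable g -> computable h ->
  computable (fun z => Nat.iter (h z) g (f z)).
Proof.
  intros Hf Hg Hh.
  apply (computable_ext (fun z => nat_rect (fun _ => nat) (f z)
           (fun m u => g (right (right ⟨z, ⟨m, u⟩⟩))) (h z))).
  - intros z. induction (h z) as [|n IH]; [reflexivity|].
    cbn [nat_rect]. rewrite !right_pair, IH. reflexivity.
  - apply (computable_nat_rect f (fun w => g (right (right w))) h); trivial.
    apply (computable_comp g); auto with computability.
Qed.

Lemma computable_add (f g : nat -> nat) :
  computable f -> computable g -> computable (fun x => f x + g x).
Proof.
  intros Hf Hg. apply (computable_ext (fun x => Nat.iter (f x) S (g x))).
  - intros x. induction (f x) as [|n IH]; [reflexivity|].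
    now rewrite Nat.iter_succ, IH.
  - apply computable_iter; auto with computability.
Qed.

Lemma computable_pred : computable Nat.pred.
Proof.
  apply (computable_ext (fun x => nat_rect (fun _ => nat) 0
           (fun m u => left (right ⟨x, ⟨m, u⟩⟩)) x)).
  - intros [|x]; [reflexivity|]. cbn [nat_rect]. now rewrite right_pair, left_pair.
  - apply (computable_nat_rect (fun _ => 0) (fun w => left (right w))
             (fun x => x)); auto with computability.
Qed.

Lemma computable_sub (f g : nat -> nat) :
  computable f -> computable g -> computable (fun x => f x - g x).
Proof.
  intros Hf Hg.
  apply (computable_ext (fun x => Nat.iter (g x) Nat.pred (f x))).
  - intros x. induction (g x) as [|n IH]; [cbn; lia|].
    rewrite Nat.iter_succ, IH. lia.
  - apply computable_iter; auto using computable_pred.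
Qed.

#[local] Hint Resolve computable_add computable_sub : computability.

(** Together with the next lemma this replaces the s-m-n theorem: an index of a program assembled
    from parts is computable from the indices of the parts. *)
Lemma computable_encode_Pair (f g : nat -> nat) :
  computable f -> computable g -> computable (fun x => 4 + 4 * ⟨f x, g x⟩).
Proof.
  intros Hf Hg. apply (computable_comp (fun p => 4 + 4 * p)); cbn [Nat.mul];
    auto 10 with computability.
Qed.

Lemma computable_encode_Comp (f g : nat -> nat) :
  computable f -> computable g -> computable (fun x => 5 + 4 * ⟨f x, g x⟩).
Proof.
  intros Hf Hg. apply computable_S. now apply computable_encode_Pair.
Qed.

#[local] Hint Resolve computable_encode_Pair computable_encode_Comp : computability.

(** * Programs with prescribed domains *)

(** Pairing forces the run of [d] on [g x] to halt before [f x] is returned; the projection discards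
    its result. *)
Lemma restrict_code (d : code) (f g : nat -> nat) :
  computable f -> computable g ->
  exists c, forall x y, eval c x y <-> y = f x /\ exists z, eval d (g x) z.
Proof.
  intros [cf Hf]%computableP [cg Hg]%computableP.
  exists (Comp Left (Pair cf (Comp d cg))). intros x y. cbn [eval]. split.
  - intros (p & (u & v & Hu & (w & Hw & Hv) & ->) & ->).
    rewrite Cantor.cancel_of_to. cbn [fst].
    rewrite (eval_functional _ _ _ _ Hu (Hf x)). split; [reflexivity|].
    exists v. now rewrite <- (eval_functional _ _ _ _ Hw (Hg x)).
  - intros (-> & z & Hz). exists ⟨f x, z⟩.
    rewrite Cantor.cancel_of_to. split; [|reflexivity].
    exists (f x), z. split; [apply Hf|]. split; [|reflexivity].
    exists (g x). auto.
Qed.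

Lemma eq_domain_code (f : nat -> nat) (k : nat) :
  computable f -> exists c, forall x, (exists y, eval c x y) <-> f x = k.
Proof.
  intros Hf.
  (* The two truncated differences add up to the distance from [f x] to [k]. It ignores the search
     variable, so the search stops at [0] or never. *)
  assert (H : computable (fun z => (f (left z) - k) + (k - f (left z)))).
  { assert (computable (fun z => f (left z)))
      by (apply (computable_comp f); auto with computability).
    auto with computability. }
  apply computableP in H. destruct H as [c Hc].
  exists (Mu c). intros x. cbn [eval]. split.
  - intros (y & H & _).
    pose proof (eval_functional _ _ _ _ H (Hc _)) as E. rewrite left_pair in E. lia.
  - intros E. exists 0. split; [|intros; lia].
    specialize (Hc ⟨x, 0⟩). rewrite left_pair, E, Nat.sub_diag in Hc. exact Hc.
Qed.

(** * Undecidability of emptiness *)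

Fixpoint constant_code (k : nat) : code :=
  match k with 0 => Zero | S k => Comp Succ (constant_code k) end.

Lemma eval_constant_code (k x y : nat) : eval (constant_code k) x y <-> y = k.
Proof.
  revert y. induction k as [|k IH]; intros y; cbn; [reflexivity|]. split.
  - intros (u & Hu & ->). f_equal. now apply IH.
  - intros ->. exists k. split; [now apply IH|reflexivity].
Qed.

Lemma computable_encode_constant_code :
  computable (fun k => encode (constant_code k)).
Proof.
  apply (computable_ext
    (fun k => Nat.iter k (fun u => 5 + 4 * ⟨encode Succ, u⟩) 0)).
  - intros k. induction k as [|k IH]; [reflexivity|].
    change (encode (constant_code (S k)))
      with (5 + 4 * ⟨encode Succ, encode (constant_code k)⟩).
    rewrite <- IH. reflexivity.
  - apply (computable_iter (fun _ => 0)); auto with computability.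
Qed.

Theorem emptiness_not_decidable (g : nat -> nat) (k : nat) :
  computable g -> ~ forall e, g e = k <-> forall n y, ~ phi e n y.
Proof.
  intros Hg H.
  (* [s e] indexes the program that ignores its input and runs program [e] on [e]; [5] is the tag of
     [Comp]. *)
  pose (s := fun e => 5 + 4 * ⟨e, encode (constant_code e)⟩).
  assert (Hs : computable (fun e => g (s e))).
  { apply (computable_comp g); trivial. unfold s.
    auto using computable_encode_constant_code with computability. }
  destruct (eq_domain_code _ k Hs) as [d Hd].
  (* [d] halts on [e] exactly if [g (s e) = k]; it is now run on its own index. *)
  specialize (Hd (encode d)).
  assert (Hdiag : forall n y, phi (s (encode d)) n y <-> eval d (encode d) y).
  { intros n y.
    change (s (encode d)) with (encode (Comp d (constant_code (encode d)))).
    rewrite phi_encode. cbn [eval]. split.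
    - intros (u & ->%eval_constant_code & Hy). exact Hy.
    - intros Hy. exists (encode d). now rewrite eval_constant_code. }
  rewrite H in Hd.
  assert (Hn : ~ exists y, eval d (encode d) y).
  { intros Hy. destruct (Hy) as [y Hy'].
    apply (proj1 Hd Hy 0 y). now apply Hdiag. }
  apply Hn, Hd. intros n y Hy. apply Hn. exists y. now apply (Hdiag n).
Qed.

(** * The jump does not reduce to equality *)

Lemma FS_jump_range (E : relation nat) (e e' w x : nat) :
  Equivalence E -> FS_jump E e e' -> phi e w x ->
  exists w' y, phi e' w' y /\ E x y.
Proof.
  intros HE [H _] Hx.
  destruct (H (eclass E x)) as (w' & y & Hy & _ & Hxy).
  { exists w, x. split; [exact Hx|split; intros z Hz; exact Hz]. }
  (* [y] lies in its own class, which is included in the class of [x]. *)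
  exists w', y. split; [exact Hy|]. apply Hxy. red. red. reflexivity.
Qed.

Lemma FS_jump_refl (E : relation nat) (e : nat) : FS_jump E e e.
Proof. split; intros C H; exact H. Qed.

Lemma FS_jump_sym (E : relation nat) (e e' : nat) :
  FS_jump E e e' -> FS_jump E e' e.
Proof. now intros [H1 H2]. Qed.

Lemma FS_jump_empty (E : relation nat) (e : nat) :
  Equivalence E ->
  FS_jump E e (encode (Mu Succ)) <-> forall n y, ~ phi e n y.
Proof.
  intros HE.
  (* [Mu Succ] searches for a zero of the successor function. *)
  assert (H0 : forall n y, ~ phi (encode (Mu Succ)) n y).
  { intros n y [H _]%phi_encode. discriminate H. }
  split.
  - intros H n y Hy.
    destruct (FS_jump_range E _ _ n y HE H Hy) as (w & z & Hz & _).
    exact (H0 _ _ Hz).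
  - intros H. split; intros C (n & y & Hy & _); exfalso.
    + exact (H _ _ Hy).
    + exact (H0 _ _ Hy).
Qed.

Lemma FS_jump_not_reducible_to_eq (E : relation nat) :
  Equivalence E -> ~ reducible (FS_jump E) (@eq nat).
Proof.
  intros HE (g & Hg & H).
  apply (emptiness_not_decidable g (g (encode (Mu Succ))) Hg).
  intros e. rewrite <- H. now apply FS_jump_empty.
Qed.

(** * Fresh numbers and their count *)

(** For an equivalence relation these are the least elements of the classes. *)
Definition fresh (E : relation nat) (x : nat) : Prop :=
  forall v, v < x -> ~ E x v.

(** The number [0], although fresh, is not counted. *)
Inductive fresh_count (E : relation nat) : nat -> nat -> Prop :=
| fresh_count_0 : fresh_count E 0 0
| fresh_count_fresh x k :
    fresh_count E x k -> fresh E (S x) -> fresh_count E (S x) (S k)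
| fresh_count_stale x k :
    fresh_count E x k -> ~ fresh E (S x) -> fresh_count E (S x) k.

(** Induction along the count of [y]. When [x] is the number just entered, its freshness decides how
    both counts end. *)
Lemma fresh_count_mono (E : relation nat) (x y k l : nat) :
  fresh_count E x k -> fresh_count E y l -> x <= y -> k <= l.
Proof.
  intros Hx Hy. revert x k Hx.
  induction Hy as [|y l Hy IH Hf|y l Hy IH Hf]; intros x k Hx Hxy.
  - inversion Hx; lia.
  - destruct (Nat.eq_dec x (S y)) as [->|].
    + inversion Hx; subst; [|contradiction]. apply le_n_S. eauto.
    + apply le_S, (IH x); [exact Hx|lia].
  - destruct (Nat.eq_dec x (S y)) as [->|].
    + inversion Hx; subst; [contradiction|]. eauto.
    + apply (IH x); [exact Hx|lia].
Qed.

(** Otherwise every number descends through smaller equivalent ones to some number at most [x], so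
    [0, ..., x] meet every class. *)
Lemma fresh_unbounded (E : relation nat) (x : nat) :
  Equivalence E -> infinitely_many_classes E -> exists y, x < y /\ fresh E y.
Proof.
  intros HE Hinf. apply NNPP. intros Hno. apply Hinf.
  exists (seq 0 (S x)). intros y.
  induction y as [y IH] using (well_founded_induction lt_wf).
  destruct (Nat.le_gt_cases y x) as [Hy|Hy].
  - exists y. split; [apply in_seq; lia|reflexivity].
  - destruct (classic (exists v, v < y /\ E y v)) as [(v & Hv & Hyv)|Hf].
    + destruct (IH v Hv) as (u & Hu & Hvu). exists u. split; [exact Hu|].
      now transitivity v.
    + exfalso. apply Hno. exists y. split; [exact Hy|].
      intros v Hv Hyv. apply Hf. now exists v.
Qed.

(** The first fresh number above [x] is taken; [d] bounds the walk by a fresh number already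
    known. *)
Lemma next_fresh (E : relation nat) (d x k : nat) :
  fresh_count E x k -> fresh E (S (d + x)) ->
  exists y, fresh E y /\ fresh_count E y (S k).
Proof.
  revert x. induction d as [|d IH]; intros x Hx Hf.
  - exists (S x). split; [exact Hf|now constructor].
  - destruct (classic (fresh E (S x))) as [H|H].
    + exists (S x). split; [exact H|now constructor].
    + apply (IH (S x)); [now constructor|]. now rewrite Nat.add_succ_r.
Qed.

Lemma nth_fresh (E : relation nat) (n : nat) :
  Equivalence E -> infinitely_many_classes E ->
  exists x, fresh E x /\ fresh_count E x n.
Proof.
  intros HE Hinf. induction n as [|n (x & _ & Hx)].
  - exists 0. split; [intros v Hv; lia|constructor].
  - destruct (fresh_unbounded E x HE Hinf) as (y & Hxy & Hy).
    apply (next_fresh E (y - S x) x n Hx).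
    now replace (S (y - S x + x)) with y by lia.
Qed.

(** * Justified steps and their enumeration *)

(** The stretch between two free steps: each number entered is equivalent to a smaller one, so none
    is fresh. *)
Inductive climb (E : relation nat) (x : nat) : nat -> Prop :=
| climb_refl : climb E x x
| climb_step y v : climb E x y -> v <= y -> E (S y) v -> climb E x (S y).

(** The argument [r = ⟨l, t⟩] asks for [t] steps, the pairs nested in [l] listing
    the witnesses [v] in the form [y - j]. *)
Lemma climb_code (E : relation nat) :
  ce_pairs E ->
  exists c, forall x y, (exists r, eval c ⟨x, r⟩ y) <-> climb E x y.
Proof.
  intros [e He]. destruct (encode_surj e) as [d <-].
  (* The state [s] holds the current number and the witnesses still to be read; [right (right w)]
     extracts it from the argument that [Prec] passes. Truncated subtraction makes [v <= y]
     automatic. *)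
  destruct (restrict_code d
    (fun w => let s := right (right w) in ⟨S (left s), right (right s)⟩)
    (fun w => let s := right (right w) in
              ⟨S (left s), left s - left (right s)⟩)) as [step Hstep];
    [cbv zeta; auto 10 with computability..|].
  pose proof computable_id as [i Hi]%computableP.
  (* The argument is repacked for [Prec]: [⟨x, l⟩] is the initial state, [t] the number of rounds.
     Only the number reached is kept. *)
  assert (Hloop : exists c, forall x l t y,
    eval c ⟨x, ⟨l, t⟩⟩ y <->
    exists s, eval (Prec i step) ⟨⟨x, l⟩, t⟩ s /\ y = left s).
  { exists (Comp Left (Comp (Prec i step)
      (Pair (Pair Left (Comp Left Right)) (Comp Right Right)))).
    intros x l t y. split.
    - intros (s & (p & (u & v & (u1 & u2 & H1 & (p2 & H2 & H3) & Hu)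
                              & (p3 & H4 & H5) & Hp) & Hs) & Hy).
      cbn [eval] in H1, H2, H3, H4, H5. subst.
      rewrite !Cantor.cancel_of_to in Hs. cbn [fst snd] in Hs.
      rewrite Cantor.cancel_of_to in Hs. cbn [fst snd] in Hs.
      now exists s.
    - intros (s & Hs & ->). exists s. split; [|reflexivity].
      exists ⟨⟨x, l⟩, t⟩. split; [|exact Hs].
      exists ⟨x, l⟩, t. repeat split.
      + exists x, l. repeat split; [symmetry; apply left_pair|].
        exists ⟨l, t⟩. split; symmetry; [apply right_pair|apply left_pair].
      + exists ⟨l, t⟩. split; symmetry; apply right_pair. }
  destruct Hloop as [c Hc]. exists c. intros x y. split.
  - intros [r Hr]. rewrite <- (pair_left_right r) in Hr.
    apply Hc in Hr. destruct Hr as (s & Hs & ->).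
    revert Hs. generalize (left r) (right r). intros l t. revert s.
    induction t as [|t IH]; intros s Hs.
    + apply eval_Prec_0 in Hs.
      rewrite (eval_functional _ _ _ _ Hs (Hi _)), left_pair. constructor.
    + apply eval_Prec_S in Hs. destruct Hs as (u & Hu & Hs).
      apply Hstep in Hs. cbn zeta in Hs. rewrite !right_pair in Hs.
      destruct Hs as (-> & z & Hz). rewrite left_pair.
      apply climb_step with (v := left u - left (right u)); [auto|lia|].
      apply He. exists z. now apply phi_encode.
  - intros H.
    (* The unread rest [l'] is arbitrary because the induction appends the last step of the climb,
       whose witness must be found in what the earlier steps leave unread. *)
    enough (exists t, forall l', exists l,
              eval (Prec i step) ⟨⟨x, l⟩, t⟩ ⟨y, l'⟩) as [t Ht].
    { destruct (Ht 0) as [l Hl]. exists ⟨l, t⟩. apply Hc.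
      exists ⟨y, 0⟩. now rewrite left_pair. }
    induction H as [|y v _ [t Ht] Hv HE].
    + exists 0. intros l'. exists l'. apply eval_Prec_0, Hi.
    + exists (S t). intros l'. destruct (Ht ⟨y - v, l'⟩) as [l Hl].
      exists l. apply eval_Prec_S. exists ⟨y, ⟨y - v, l'⟩⟩.
      split; [exact Hl|]. apply Hstep. cbn zeta.
      rewrite !right_pair, !left_pair. split; [reflexivity|].
      replace (y - (y - v)) with v by lia.
      apply He in HE. destruct HE as [z Hz]. exists z. now apply phi_encode.
Qed.

(** * Programs with [n] free steps and their separation *)

(** The input nests one guide [r] per climb. Each round climbs and then takes a free step; a climb
    after the last round would enter no fresh number. *)
Fixpoint reach_code (c : code) (n : nat) : code :=
  match n with
  | 0 => Zero
  | S n => Comp (Comp Succ c) (Pair (Comp (reach_code c n) Left) Right)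
  end.

Lemma computable_encode_reach_code (c : code) :
  computable (fun n => encode (reach_code c n)).
Proof.
  (* [g] performs one unfolding of [reach_code] on numerical codes, with tag [5] for [Comp] and [4]
     for [Pair]. *)
  pose (g := fun u => 5 + 4 * ⟨encode (Comp Succ c),
                4 + 4 * ⟨5 + 4 * ⟨u, encode Left⟩, encode Right⟩⟩).
  apply (computable_ext (fun n => Nat.iter n g 0)).
  - intros n. induction n as [|n IH]; [reflexivity|].
    change (encode (reach_code c (S n))) with (g (encode (reach_code c n))).
    rewrite <- IH. reflexivity.
  - apply (computable_iter (fun _ => 0)); unfold g;
      auto with computability.
Qed.

Section Reach.

Variables (E : relation nat) (c : code).
Hypothesis Hc : forall x y, (exists r, eval c ⟨x, r⟩ y) <-> climb E x y.

Lemma range_reach_code_S (n y : nat) :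
  (exists w, eval (reach_code c (S n)) w y) <->
  exists w x z, eval (reach_code c n) w x /\ climb E x z /\ y = S z.
Proof.
  split.
  - intros (w & p & (x & r & (q & _ & Hx) & _ & ->) & z & Hz & Hy).
    exists q, x, z. split; [exact Hx|]. split; [|exact Hy].
    apply Hc. now exists r.
  - intros (w & x & z & Hx & Hz & ->).
    apply Hc in Hz. destruct Hz as [r Hr].
    exists ⟨w, r⟩, ⟨x, r⟩. split; [|now exists z].
    exists x, r. split; [exists w|]; (split; [|trivial]); trivial;
      symmetry; [apply left_pair|apply right_pair].
Qed.

Lemma climb_fresh_count (x y k : nat) :
  climb E x y -> fresh_count E x k -> fresh_count E y k.
Proof.
  intros H Hx. induction H as [|y v _ IH Hv HE]; trivial.
  constructor; trivial. intros Hf. apply (Hf v); [lia|exact HE].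
Qed.

(** Climbing keeps the count, and a free step raises it by at most one: it may be spent on a number
    that is not fresh. *)
Lemma reach_code_sound (n w x : nat) :
  eval (reach_code c n) w x -> exists k, k <= n /\ fresh_count E x k.
Proof.
  revert w x. induction n as [|n IH]; intros w x H.
  - cbn in H. subst x. exists 0. split; [trivial|constructor].
  - destruct (proj1 (range_reach_code_S n x) (ex_intro _ w H))
      as (w' & x' & z & Hx' & Hz & ->).
    destruct (IH _ _ Hx') as (k & Hk & Hkx).
    pose proof (climb_fresh_count _ _ _ Hz Hkx) as Hkz.
    destruct (classic (fresh E (S z))).
    + exists (S k). split; [lia|now constructor].
    + exists k. split; [lia|now constructor].
Qed.

(** Free steps are spent exactly on the fresh numbers; any other number has a smaller equivalent
    that justifies climbing onto it. *)
Lemma reach_code_complete (n x : nat) :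
  fresh_count E x n -> exists w y, eval (reach_code c n) w y /\ climb E y x.
Proof.
  induction 1 as [|x k _ (w & y & Hy & Hyx) Hf|x k _ (w & y & Hy & Hyx) Hf].
  - exists 0, 0. split; [reflexivity|constructor].
  - destruct (proj2 (range_reach_code_S k (S x))) as [w' Hw'].
    { now exists w, y, x. }
    exists w', (S x). split; [exact Hw'|constructor].
  - exists w, y. split; [exact Hy|].
    apply NNPP. intros Hn. apply Hf. intros v Hv HE. apply Hn.
    apply climb_step with v; [exact Hyx|lia|exact HE].
Qed.

(** A nonempty climb cannot end at a fresh number, so the climb given by completeness is empty. *)
Lemma reach_code_fresh (n x : nat) :
  fresh_count E x n -> fresh E x -> exists w, eval (reach_code c n) w x.
Proof.
  intros Hx Hf. destruct (reach_code_complete n x Hx) as (w & y & Hy & H).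
  destruct H as [|x v _ Hv HE]; [now exists w|].
  exfalso. apply (Hf v); [lia|exact HE].
Qed.

Lemma reach_code_separated (n m : nat) :
  Equivalence E -> infinitely_many_classes E ->
  FS_jump E (encode (reach_code c n)) (encode (reach_code c m)) -> m <= n.
Proof.
  intros HE Hinf H.
  destruct (nth_fresh E m HE Hinf) as (x & Hf & Hx).
  destruct (reach_code_fresh m x Hx Hf) as [w Hw].
  apply phi_encode in Hw.
  destruct (FS_jump_range E _ _ w x HE (FS_jump_sym E _ _ H) Hw)
    as (w' & y & Hy%phi_encode & Hxy).
  destruct (reach_code_sound n w' y Hy) as (k & Hk & Hky).
  transitivity k; [|exact Hk].
  apply (fresh_count_mono E x y m k Hx Hky).
  (* No number below the fresh [x] is equivalent to it, so [x <= y]. *)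
  apply Nat.nlt_ge. intros Hlt. exact (Hf y Hlt Hxy).
Qed.

End Reach.

Theorem theorem4p2 (E : relation nat) (hE : ceer E)
    (hinf : infinitely_many_classes E) :
  strictly_reducible (@eq nat) (FS_jump E).
Proof.
  destruct hE as [HE Hce]. split.
  - destruct (climb_code E Hce) as [c Hc].
    exists (fun n => encode (reach_code c n)).
    split; [apply computable_encode_reach_code|].
    intros n m. split.
    + intros ->. apply FS_jump_refl.
    + intros H. apply Nat.le_antisymm;
        eapply reach_code_separated; eauto using FS_jump_sym.
  - now apply FS_jump_not_reducible_to_eq.
Qed.
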